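(* Let $\mathcal{H}$ be a separable complex Hilbert space, let $C\in GL(\mathcal{H})$ be self-adjoint, and let $\Lambda=\{\Lambda_i\}_{i\in J}$ be a family with $\Lambda_i\in\mathcal{L}(\mathcal{H},\mathcal{H}_i)$. Then $\Lambda$ is a g-frame for $\mathcal{H}$ controlled by $C$ if and only if $\Lambda$ is a (classical) g-frame for $\mathcal{H}$, $C$ is positive, and $C$ commutes with the g-frame operator $S$ of $\Lambda$.
   Context: $J\subseteq\mathbb{Z}$ is an index set, $\{\mathcal{H}_i\}_{i\in J}$ is a sequence of separable complex Hilbert spaces, $\mathcal{L}(\mathcal{H},\mathcal{H}_i)$ is the set of bounded linear operators $\mathcal{H}\to\mathcal{H}_i$, and $GL(\mathcal{H})$ is the set of bounded linear operators on $\mathcal{H}$ with bounded inverse. A g-frame controlled by $C$ is a family $\{\Lambda_i\}_{i\in J}$, $\Lambda_i\in\mathcal{L}(\mathcal{H},\mathcal{H}_i)$, for which there exist constants $m_{CL}>0$ and $M_{CL}<\infty$ with $m_{CL}\|f\|^2\le\sum_{i\in J}\langle\Lambda_iC^{\star}f,\Lambda_if\rangle\le M_{CL}\|f\|^2$ for all $f\in\mathcal{H}$ (the sum being required to converge to a real number). A family is a (classical) g-frame if there are $A,B>0$ with $A\|f\|^2\le\sum_{i\in J}\|\Lambda_if\|^2\le B\|f\|^2$ for all $f\in\mathcal{H}$; its g-frame operator is $Sf=\sum_{i\in J}\Lambda_i^{\star}\Lambda_if$. *)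

(* Defs.v *)
From HB Require Import structures.
From mathcomp Require Import all_boot all_order all_algebra finmap complex.
From mathcomp Require Import all_classical all_reals topology normedtype.
From mathcomp Require Export summability.

Set Implicit Arguments.
Unset Strict Implicit.
Unset Printing Implicit Defensive.

Import Order.TTheory GRing.Theory Num.Theory.
Import numFieldNormedType.Exports.

Local Open Scope classical_set_scope.
Local Open Scope ring_scope.
Local Open Scope complex_scope.

(* [R[i]] is a concrete type, so it does not pick up the normed module
   structure that [numFieldNormedType] gives to abstract [numClosedFieldType]s. *)
HB.instance Definition _ (R : realType) := NormedModule.copy R[i] R[i]^o.

(* The inner product is linear in its first argument and conjugate-linear in
   the second. *)
HB.mixin Record NormedModule_isHilbert (R : realType) H
    & CompleteNormedModule R[i] H := {
  inner : {dot H for (@Num.conj R[i])} ;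
  normr_inner : forall x : H, `|x| ^+ 2 = inner x x
}.

#[short(type="hilbertType")]
HB.structure Definition Hilbert (R : realType) :=
  {H of NormedModule_isHilbert R H & CompleteNormedModule R[i] H}.

Definition separable (T : topologicalType) : Prop :=
  exists2 D : set T, countable D & dense D.

Section operators.
Context {R : realType}.

Definition bounded_op {H K : hilbertType R} (T : {linear H -> K}) : Prop :=
  bounded_near T (nbhs 0).

Definition inGL {H : hilbertType R} (T : {linear H -> H}) : Prop :=
  bounded_op T /\
  exists U : {linear H -> H}, [/\ bounded_op U, cancel T U & cancel U T].

(* For bounded [T], Riesz representation gives exactly one such [z]; the
   default value is only reached when [T] is unbounded. *)
Definition adjoint {H K : hilbertType R} (T : {linear H -> K}) (y : K) : H :=
  xget 0 [set z : H | forall x : H, inner (T x) y = inner x z].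

Definition self_adjoint {H : hilbertType R} (T : {linear H -> H}) : Prop :=
  adjoint T = T.

Definition positive_op {H : hilbertType R} (T : {linear H -> H}) : Prop :=
  forall f : H, 0 <= inner (T f) f.

End operators.

(* [sum x] is the limit of the sums of [x] over the finite subsets of the index
   type, ordered by inclusion, i.e. the unconditional sum; [unconditional_cvg x]
   states that this limit exists. *)
Definition unconditional_cvg {I : choiceType} {K : numDomainType}
    {V : normedModType K} (x : I -> V) : Prop :=
  cvg (partial_sum x @ totally).

Section gframes.
Context {R : realType} {H : hilbertType R} {J : set int}.
Context {H_ : J -> hilbertType R}.
Implicit Type L : forall i : J, {linear H -> H_ i}.

Definition controlled_gframe (C : {linear H -> H}) L : Prop :=
  exists m M : R, 0 < m /\
    forall f : H,
      let x := fun i : J => inner (L i (adjoint C f)) (L i f) in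
      [/\ unconditional_cvg x, sum x \is Num.real,
          m%:C * `|f| ^+ 2 <= sum x & sum x <= M%:C * `|f| ^+ 2].

Definition gframe L : Prop :=
  exists A B : R, [/\ 0 < A, 0 < B &
    forall f : H,
      let x := fun i : J => `|L i f| ^+ 2 in
      [/\ unconditional_cvg x,
          A%:C * `|f| ^+ 2 <= sum x & sum x <= B%:C * `|f| ^+ 2]].

Definition gframe_op L (f : H) : H :=
  sum (fun i : J => adjoint (L i) (L i f)).

End gframes.

(* Main.v *)
(* Let <f, g>_S be the sum of the <L_i f, L_i g>.

   If L is controlled by C, polarizing <L_i C f, L_i f> and substituting C^-1 f
   for f shows that <f, f>_S converges for all f.  As <C f, f>_S is real and
   comparable to |f|^2, C is symmetric for <,>_S, and Cauchy-Schwarz for the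
   forms <C f, g>_S and <f, g>_S bounds <f, f>_S from above and from below.
   Symmetry of C for <,>_S means that C commutes with S.

   So in both directions C is symmetric for two equivalent inner products, <,>
   and <,>_S, and what remains is that bounded-below positivity for one of them
   passes to the other ([psd_transfer]): the spectrum of C does not depend on
   the inner product.  Concretely, a lower bound for <C f, f> that is <= 0 can
   be improved by a uniform amount, and finitely many steps make it positive. *)
Require Import Defs.
From mathcomp Require Import all_boot all_order all_algebra finmap complex.
From mathcomp Require Import all_classical all_reals topology normedtype.
From mathcomp Require Import interval_inference ring lra.

Set Implicit Arguments.
Unset Strict Implicit.
Unset Printing Implicit Defensive.

Import Order.TTheory GRing.Theory Num.Theory.
Import numFieldNormedType.Exports.

Local Open Scope classical_set_scope.
Local Open Scope ring_scope.
Local Open Scope complex_scope.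

(** * Positive semidefinite forms *)

(* The real part of a semi-inner product, hence scaling by real numbers only. *)
Record psd_form (R : realType) (V : lmodType R[i]) (b : V -> V -> R) : Prop := {
  psdC : forall x y, b x y = b y x;
  psdD : forall x y z, b (x + y) z = b x z + b y z;
  psdZ : forall t x y, b (t%:C *: x) y = t * b x y;
  psd_ge0 : forall x, 0 <= b x x }.

Section psd_forms.
Context {R : realType} {V : lmodType R[i]}.
Implicit Types b : V -> V -> R.

Lemma psdDr b : psd_form b -> forall x y z, b x (y + z) = b x y + b x z.
Proof. by move=> bP x y z; rewrite (psdC bP) (psdD bP) !(psdC bP x). Qed.

Lemma psdZr b : psd_form b -> forall t x y, b x (t%:C *: y) = t * b x y.
Proof. by move=> bP t x y; rewrite (psdC bP) (psdZ bP) (psdC bP x). Qed.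

(** The form at [x + t y] is a nonnegative quadratic in the real [t]. The form may be degenerate, so
    [b y y = 0] is treated apart. *)
Lemma psd_cauchy_schwarz b x y : psd_form b -> b x y ^+ 2 <= b x x * b y y.
Proof.
move=> bP.
have q_ge0 t : 0 <= b x x + 2 * t * b x y + t ^+ 2 * b y y.
  have := psd_ge0 bP (x + t%:C *: y).
  rewrite (psdD bP) !(psdDr bP) !(psdZ bP) !(psdZr bP) (psdC bP y x); nra.
have [yy0|] := ltrP 0 (b y y).
  have := q_ge0 (- b x y / b y y).
  have -> : b x x + 2 * (- b x y / b y y) * b x y + (- b x y / b y y) ^+ 2 * b y y
      = (b x x * b y y - b x y ^+ 2) / b y y by field; rewrite gt_eqF.
  by rewrite pmulr_lge0 ?invr_gt0// subr_ge0.
move=> yy0; have {yy0} yy : b y y = 0 by apply/le_anti; rewrite yy0 psd_ge0.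
rewrite yy mulr0; have [->|xy0] := eqVneq (b x y) 0; first by rewrite expr0n.
(* With [b y y = 0] the quadratic is affine in [t], and this [t] gives it the value -1. *)
have := q_ge0 (- (b x x + 1) / (2 * b x y)); rewrite yy.
have -> : 2 * (- (b x x + 1) / (2 * b x y)) * b x y = - (b x x + 1) by field.
lra.
Qed.

(** Cauchy-Schwarz for the form of [P] at [x] and [P x] gives [b (P x) (P x) ^+ 2 <= b (P x) x * b
    (P (P x)) (P x)]; the last factor is at most [K * b (P x) (P x)], which cancels. *)
Lemma psd_sqr_le b (P : V -> V) K : 0 <= K -> psd_form b ->
    psd_form (fun x y => b (P x) y) -> (forall x, b (P x) x <= K * b x x) ->
  forall x, b (P x) (P x) <= K * b (P x) x.
Proof.
move=> K0 bP pP PK x; have px0 : 0 <= b (P x) x := psd_ge0 pP x.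
have [w0|w0] := lerP (b (P x) (P x)) 0.
  by rewrite (le_trans w0)// mulr_ge0.
rewrite -(ler_pM2r w0) -expr2.
apply: (le_trans (psd_cauchy_schwarz x (P x) pP)) => /=.
by rewrite [leRHS]mulrAC [leRHS]mulrC ler_wpM2l.
Qed.

(** Cauchy-Schwarz at [C x] and [x], with [K + 1] as a bound for the square root of [K]. *)
Lemma psd_normr_le b (C : V -> V) K : 0 <= K -> psd_form b ->
    (forall x, b (C x) (C x) <= K * b x x) ->
  forall x, `|b (C x) x| <= (K + 1) * b x x.
Proof.
move=> K0 bP CK x; have x0 := psd_ge0 bP x.
have K1x : 0 <= (K + 1) * b x x by rewrite mulr_ge0// addr_ge0.
rewrite -(@ler_pXn2r _ 2)// ?nnegrE// real_normK ?num_real//.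
apply: (le_trans (psd_cauchy_schwarz (C x) x bP)).
apply: (@le_trans _ _ (K * b x x * b x x)); first by rewrite ler_wpM2r.
by nra.
Qed.

(** As [x = C (U x)], Cauchy-Schwarz for the form [a (C x) y] at [U x] and [x] gives [a x x ^+ 2 <=
    a x (U x) * a (C x) x <= M ^+ 2 * K * b x x ^+ 2], and [K <= (K + 1) ^+ 2]. *)
Lemma psd_upper a b (C U : V -> V) M K : 0 < M -> 0 < K ->
    psd_form b -> psd_form (fun x y => a (C x) y) -> cancel U C ->
    (forall x, a (C x) x <= M * b x x) -> (forall x, b (U x) (U x) <= K * b x x) ->
  forall x, a x x <= M * (K + 1) * b x x.
Proof.
move=> M0 K0 bP cP CU aM UK x; have x0 := psd_ge0 bP x.
have [a0|a0] := lerP (a x x) 0.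
  by rewrite (le_trans a0)// !mulr_ge0 ?addr_ge0// ltW.
have := psd_cauchy_schwarz (U x) x cP; rewrite /= CU => cs.
have Bx : 0 <= M * (K + 1) * b x x by rewrite !mulr_ge0 ?addr_ge0// ltW.
rewrite -(@ler_pXn2r _ 2)// ?nnegrE// ?(ltW a0)//.
have h0 : 0 <= a (C x) x := psd_ge0 cP x.
have h1 : a x (U x) <= M * (K * b x x).
  by have := aM (U x); rewrite CU => /le_trans; apply; rewrite ler_pM2l.
have g0 : 0 <= a x (U x) by have := psd_ge0 cP (U x); rewrite /= CU.
apply: (le_trans cs); apply: (le_trans (ler_pM g0 h0 h1 (aM x))).
have : 0 <= M * M * (b x x) * b x x by rewrite !mulr_ge0// ltW.
nra.
Qed.

(** By Cauchy-Schwarz for [a], [(m * b x x) ^+ 2 <= a (C x) (C x) * a x x <= B * K * b x x * a x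
    x]. *)
Lemma psd_lower a b (C : V -> V) m B K : 0 < m -> 0 < B -> 0 < K ->
    psd_form a -> psd_form b ->
    (forall x, m * b x x <= a (C x) x) -> (forall x, a x x <= B * b x x) ->
    (forall x, b (C x) (C x) <= K * b x x) ->
  forall x, m ^+ 2 / (B * K) * b x x <= a x x.
Proof.
move=> m0 B0 K0 aP bP mC aB CK x; have x0 := psd_ge0 bP x.
have BK : 0 < B * K by rewrite mulr_gt0.
have [w0|w0] := lerP (b x x) 0.
  have -> : b x x = 0 by apply/le_anti; rewrite w0.
  by rewrite mulr0 (psd_ge0 aP).
rewrite mulrAC ler_pdivrMr// -(ler_pM2r w0).
have -> : m ^+ 2 * b x x * b x x = (m * b x x) ^+ 2 by ring.
have mb : 0 <= m * b x x by rewrite mulr_ge0 ?ltW.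
apply: (@le_trans _ _ (a (C x) x ^+ 2)).
  by rewrite ler_pXn2r ?nnegrE// (le_trans mb).
apply: (le_trans (psd_cauchy_schwarz _ _ aP)).
rewrite mulrC -mulrA ler_wpM2l ?(psd_ge0 aP)//.
by rewrite (le_trans (aB _))// -mulrA ler_pM2l.
Qed.

(** * Transfer of positivity between equivalent forms *)

Section transfer.
Variables (a b : V -> V -> R) (C : V -> V) (m k k' K : R).
Hypotheses (aP : psd_form a) (bP : psd_form b).
Hypotheses (m0 : 0 < m) (k0 : 0 < k) (k'0 : 0 < k') (K0 : 0 < K).
Hypothesis ab : forall x, a x x <= k * b x x.
Hypothesis ba : forall x, b x x <= k' * a x x.
Hypothesis CD : forall x y, C (x + y) = C x + C y.
Hypothesis CZ : forall t x, C (t *: x) = t *: C x.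
Hypothesis bC : forall x y, b (C x) y = b x (C y).
Hypothesis Cb : forall x, `|b (C x) x| <= K * b x x.
Hypothesis Ca : forall x, m * a x x <= a (C x) x.

(* The gain is uniform in the shift [t], since [C + t] stays bounded below in
   the [a]-norm and a positive operator [P] satisfies [|Pf|^2 <= |P| <Pf, f>]. *)
Let psd_shift_gain t : 0 <= t <= K -> (forall x, 0 <= b (C x) x + t * b x x) ->
  forall x, m ^+ 2 / (2 * K * k * k') * b x x <= b (C x) x + t * b x x.
Proof.
move=> /andP[t0 tK] P0 x.
pose P y := C y + t%:C *: y.
have PE y z : b (P y) z = b (C y) z + t * b y z by rewrite (psdD bP) (psdZ bP).
have pP : psd_form (fun y z => b (P y) z).
  split=> [y z|y z w|s y z|y].
  - by rewrite !PE bC (psdC bP y (C z)) (psdC bP y z).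
  - by rewrite !PE CD !(psdD bP); ring.
  - by rewrite !PE CZ !(psdZ bP); ring.
  - by rewrite PE.
have hb : b (P x) (P x) <= 2 * K * b (P x) x.
  apply: psd_sqr_le => // [|y]; first by rewrite mulr_ge0// ltW.
  rewrite PE; have := le_trans (ler_norm _) (Cb y); have := psd_ge0 bP y; nra.
(* As [t >= 0], the shifted operator keeps the lower bound [m] for [a]; Cauchy-Schwarz turns it into
   a lower bound on the [a]-norm of [P x]. *)
have ha : m ^+ 2 * a x x <= a (P x) (P x).
  have [w0|w0] := lerP (a x x) 0.
    apply: (@le_trans _ _ 0); last exact: psd_ge0.
    by rewrite mulr_ge0_le0// sqr_ge0.
  have cs := psd_cauchy_schwarz (P x) x aP.
  have low : m * a x x <= a (P x) x.
    by rewrite (psdD aP) (psdZ aP) ler_wpDr// mulr_ge0// ltW.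
  have : (m ^+ 2 * a x x) * a x x <= a (P x) (P x) * a x x.
    apply: le_trans cs.
    have -> : m ^+ 2 * a x x * a x x = (m * a x x) ^+ 2 by ring.
    by rewrite ler_sqr// nnegrE ?mulr_ge0 ?(ltW m0) ?(ltW w0)// (le_trans _ low)// mulr_ge0 ?ltW.
  by rewrite ler_pM2r.
rewrite -PE -(@ler_pM2l _ (2 * K * k * k')); last by rewrite !mulr_gt0.
have -> : 2 * K * k * k' * (m ^+ 2 / (2 * K * k * k') * b x x) = m ^+ 2 * b x x.
  by field; rewrite !gt_eqF.
have h1 := ba x; have h2 := ab (P x).
apply: (@le_trans _ _ (k' * (m ^+ 2 * a x x))).
  by rewrite mulrCA ler_wpM2l// sqr_ge0.
apply: (@le_trans _ _ (k' * a (P x) (P x))); first by rewrite ler_pM2l.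
apply: (@le_trans _ _ (k' * (k * b (P x) (P x)))); first by rewrite ler_pM2l.
have -> : 2 * K * k * k' * b (P x) x = k' * (k * (2 * K * b (P x) x)) by ring.
by rewrite !ler_pM2l.
Qed.

(** Serves both directions of the equivalence: [b] is the inner product in one and the frame form in
    the other. *)
Lemma psd_transfer : exists2 m', 0 < m' & forall x, m' * b x x <= b (C x) x.
Proof.
pose c := m ^+ 2 / (2 * K * k * k').
have c0 : 0 < c by rewrite divr_gt0 ?exprn_gt0// !mulr_gt0.
(* Either a positive lower bound is already found, or [n] gains of size [c] have raised the initial
   bound [- K]; an [n] beyond [K / c] ends the process. *)
have step n : (exists2 l, 0 < l & forall x, l * b x x <= b (C x) x) \/
    (forall x, (n%:R * c - K) * b x x <= b (C x) x).
  elim: n => [|n [|IH]]; [right=> x|by left|].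
    by rewrite mul0r add0r; have := Cb x; rewrite ler_norml mulNr => /andP[].
  have [gt0|le0] := ltrP 0 (n%:R * c - K); first by left; exists (n%:R * c - K).
  right=> x.
  have /(_ _ _ x) := @psd_shift_gain (K - n%:R * c); rewrite -/c.
  have nc : 0 <= n%:R * c by rewrite mulr_ge0// ltW.
  have tK : 0 <= K - n%:R * c <= K by apply/andP; split; lra.
  have tP y : 0 <= b (C y) y + (K - n%:R * c) * b y y by have := IH y; lra.
  by move=> /(_ tK tP); rewrite -natr1; lra.
have [n hn] : exists n : nat, K / c < n%:R by exists (Num.bound (K / c)); apply/archi_boundP/ltW/divr_gt0.
have [//|h] := step n; exists (n%:R * c - K) => //.
by rewrite subr_gt0 -ltr_pdivrMr.
Qed.

End transfer.
End psd_forms.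

(** * Hilbert spaces and adjoints *)

Section hilbert.
Context {R : realType} {H : hilbertType R}.
Implicit Types (x y z : H) (a : R[i]).

Lemma innerDl x y z : inner (x + y) z = inner x z + inner y z.
Proof. exact: linearDl. Qed.

Lemma innerZl a x y : inner (a *: x) y = a * inner x y.
Proof. exact: linearZl_LR. Qed.

Lemma innerC x y : inner y x = (inner x y)^*.
Proof. by rewrite (hermC (@inner R H)) /= expr0 mul1r. Qed.

Definition rinner x y : R := complex.Re (inner x y).

Lemma Re_mul_real (t : R) (w : R[i]) : complex.Re (t%:C * w) = t * complex.Re w.
Proof. by case: w => u v /=; rewrite mul0r subr0. Qed.

Lemma innerxx x : inner x x = (rinner x x)%:C.
Proof.
have : 0 <= inner x x by rewrite -normr_inner exprn_ge0.
by move=> /ger0_Im; rewrite /rinner; case: (inner x x) => u v /= ->.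
Qed.

Lemma sqr_norm x : `|x| ^+ 2 = (rinner x x)%:C.
Proof. by rewrite normr_inner innerxx. Qed.

Lemma rinner_psd : psd_form rinner.
Proof.
split=> [x y|x y z|t x y|x].
- by rewrite /rinner innerC; case: (inner y x).
- by rewrite /rinner innerDl raddfD.
- by rewrite /rinner innerZl Re_mul_real.
- by rewrite -ler0c -innerxx -normr_inner exprn_ge0.
Qed.

Lemma norm_rinner_lt x (e : R) : 0 < e -> (`|x| < e%:C) = (rinner x x < e ^+ 2).
Proof.
move=> e0; rewrite -ltcR -sqr_norm rmorphXn/= ltr_pXn2r//;
  by rewrite nnegrE ?normr_ge0 ?ler0c ?ltW.
Qed.

Lemma rinner_eq0 x : rinner x x = 0 -> x = 0.
Proof. by move=> x0; apply/eqP; rewrite -normr_eq0 -sqrf_eq0 sqr_norm x0. Qed.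

Lemma rinnerC x y : rinner x y = rinner y x. Proof. exact: psdC rinner_psd x y. Qed.

Lemma rinnerDl x y z : rinner (x + y) z = rinner x z + rinner y z.
Proof. exact: psdD rinner_psd x y z. Qed.

Lemma rinnerDr x y z : rinner x (y + z) = rinner x y + rinner x z.
Proof. exact: psdDr rinner_psd x y z. Qed.

Lemma rinnerZl (t : R) x y : rinner (t%:C *: x) y = t * rinner x y.
Proof. exact: psdZ rinner_psd t x y. Qed.

Lemma rinnerZr (t : R) x y : rinner x (t%:C *: y) = t * rinner x y.
Proof. exact: psdZr rinner_psd t x y. Qed.

Lemma rinner0l x : rinner 0 x = 0.
Proof. by rewrite -(scale0r 0) rinnerZl mul0r. Qed.

Lemma rinnerNl x y : rinner (- x) y = - rinner x y.
Proof. by rewrite -scaleN1r -(rmorphN1 (real_complex R)) rinnerZl mulN1r. Qed.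

Lemma rinnerNr x y : rinner x (- y) = - rinner x y.
Proof. by rewrite rinnerC rinnerNl rinnerC. Qed.

Definition rinnerE := (rinnerDl, rinnerDr, rinnerZl, rinnerZr, rinnerNl, rinnerNr).

Lemma rinner_ge0 x : 0 <= rinner x x.
Proof. exact: psd_ge0 rinner_psd x. Qed.

Lemma rinner_inj x y : (forall z, rinner x z = rinner y z) -> x = y.
Proof.
move=> xy; apply/subr0_eq/rinner_eq0.
by rewrite rinnerDl xy -rinnerDl subrr rinner0l.
Qed.

End hilbert.

(** The scalars 1 and ['i] recover the real and imaginary parts. This lifts identities of real
    forms, such as those from [riesz], to complex inner products. *)
Lemma inner_eqP {R : realType} {H K : hilbertType R} (x y : H) (x' y' : K) :
  (forall a : R[i], rinner (a *: x) y = rinner (a *: x') y') -> inner x y = inner x' y'.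
Proof.
move=> xy; have := xy 1; have := xy 'i%C.
rewrite /rinner !innerZl !mul1r; case: (inner x y) => u v; case: (inner x' y') => u' v' /=.
by rewrite !mul0r !mul1r !sub0r => /oppr_inj -> ->.
Qed.

Section bounded.
Context {R : realType} {H K : hilbertType R}.

Lemma bounded_op_rinner (T : {linear H -> K}) : bounded_op T ->
  exists2 M : R, 0 < M & forall x, rinner (T x) (T x) <= M * rinner x x.
Proof.
move=> /linear_boundedP/pinfty_ex_gt0[M M0 TM].
have MM : M = (complex.Re M)%:C by rewrite RRe_real ?gtr0_real.
have rM0 : 0 < complex.Re M by rewrite -ltcR -MM.
exists (complex.Re M ^+ 2); rewrite ?exprn_gt0// => x.
rewrite -lecR rmorphM/= -!sqr_norm rmorphXn/= -MM -exprMn.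
rewrite ler_pXn2r// ?nnegrE ?mulr_ge0// ?ltW//; exact: TM.
Qed.

End bounded.

(** * Riesz representation of real functionals *)

Section riesz.
Context {R : realType} {H : hilbertType R}.

Lemma cvg_rinnerP {T} {F : set_system T} {FF : Filter F} (u : T -> H) z :
  u @ F --> z <->
  forall e : R, 0 < e -> \forall n \near F, rinner (z - u n) (z - u n) < e.
Proof.
split=> [/cvgrPdist_lt uz e e0|uz].
  have se0 : 0 < Num.sqrt e by rewrite sqrtr_gt0.
  have : 0 < (Num.sqrt e)%:C by rewrite ltcR.
  move=> /uz; apply: filterS => n.
  by rewrite norm_rinner_lt// sqr_sqrtr// ltW.
apply/cvgrPdist_lt => e e0.
have eE : e = (complex.Re e)%:C by rewrite RRe_real ?gtr0_real.
have re0 : 0 < complex.Re e by rewrite -ltcR -eE.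
apply: filterS (uz _ (exprn_gt0 2 re0)) => n.
by rewrite eE norm_rinner_lt.
Qed.

Variables (phi : H -> R) (M : R).
Hypothesis M0 : 0 <= M.
Hypothesis phiD : forall x y, phi (x + y) = phi x + phi y.
Hypothesis phiZ : forall t x, phi (t%:C *: x) = t * phi x.
Hypothesis phi_le : forall x, phi x ^+ 2 <= M * rinner x x.

(** If [z] represents [phi], then [q x] is the squared distance from [x] to [z] minus the squared
    norm of [z]; so [z] is sought as the minimizer of [q]. *)
Let q x := rinner x x - 2 * phi x.
Let d := inf (range q).

(** By the arithmetic-geometric mean inequality, [2 * phi x] is at most [M + rinner x x]. *)
Let q_ge x : - M <= q x.
Proof.
have := phi_le x; have := psd_ge0 rinner_psd x; rewrite /q.
move: (rinner x x) (phi x) => r p r0 pr; rewrite leNgt; apply/negP => lt.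
have rM : 0 <= r + M by rewrite addr_ge0.
have rp : r + M < 2 * p by lra.
have : (r + M) ^+ 2 < (2 * p) ^+ 2.
  by rewrite ltr_pXn2r// nnegrE// ltW// (le_lt_trans rM).
have := sqr_ge0 (r - M); nra.
Qed.

Let q_inf : has_inf (range q).
Proof. by split; [exists (q 0), 0|exists (- M) => _ [x _ <-]; exact: q_ge]. Qed.

Let d_le x : d <= q x.
Proof. by apply: ge_inf; [case: q_inf|exists x]. Qed.

(** Parallelogram law: compare [d] with the value of [q] at the midpoint of [u] and [v]. *)
Let near_minimizers u v : 
  rinner (u - v) (u - v) <= 2 * ((q u - d) + (q v - d)).
Proof.
have := d_le ((2^-1)%:C *: (u + v)); rewrite /q phiZ phiD.
rewrite !rinnerE (rinnerC v u); lra.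
Qed.

(** The quadratic [q (u + t x) - d] in [t] is nonnegative; evaluate it at its minimizer. *)
Let near_stationary u x : (phi x - rinner x u) ^+ 2 <= (q u - d) * rinner x x.
Proof.
have phi0 : phi 0 = 0 by have := phiD 0 0; rewrite addr0; lra.
have qd t : 0 <= t ^+ 2 * rinner x x - 2 * t * (phi x - rinner x u) + (q u - d).
  have := d_le (u + t%:C *: x); rewrite /q phiD phiZ.
  rewrite !rinnerE (rinnerC u x); lra.
have [x0|] := ltrP 0 (rinner x x); last first.
  move=> x0; have {x0} x0 : rinner x x = 0.
    by apply/le_anti; rewrite x0 rinner_ge0.
  by rewrite (rinner_eq0 x0) phi0 !rinner0l subr0 expr0n mulr0.
have := qd ((phi x - rinner x u) / rinner x x).
set p := phi x - rinner x u; set r := rinner x x; set e := q u - d.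
have -> : (p / r) ^+ 2 * r - 2 * (p / r) * p + e = (e * r - p ^+ 2) / r.
  by field; rewrite gt_eqF.
by rewrite pmulr_lge0 ?invr_gt0// subr_ge0.
Qed.

(** A minimizing sequence is Cauchy by [near_minimizers], and [near_stationary] passes to its
    limit. *)
Lemma riesz : exists z, forall x, phi x = rinner x z.
Proof.
have /choice[u uP] (n : nat) : exists u, q u - d < n.+1%:R^-1.
  have n0 : 0 < (n.+1%:R^-1 : R) by rewrite invr_gt0.
  have [_ [x _ <-]] := inf_adherent n0 q_inf.
  by exists x; rewrite ltrBlDl.
have uN (e : R) : 0 < e -> \forall n \near \oo, q (u n) - d < e.
  move=> /posnumP[{}e]; near=> n; apply: (lt_trans (uP n)).
  by near: n; exact: near_infty_natSinv_lt.
have : cauchy (u @ \oo).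
  apply/cauchy_exP => e e0.
  have eE : e = (complex.Re e)%:C by rewrite RRe_real ?gtr0_real.
  have re0 : 0 < complex.Re e by rewrite -ltcR -eE.
  have /uN[N _ NP] : 0 < complex.Re e ^+ 2 / 4 by rewrite divr_gt0// exprn_gt0.
  exists (u N); exists N => // n Nn /=.
  rewrite -ball_normE /= eE norm_rinner_lt// (le_lt_trans (near_minimizers _ _))//.
  have := NP N (leqnn N); have := NP n Nn => /=; lra.
move=> /cauchy_cvg/cvg_ex[z uz]; exists z => x.
apply/eqP; rewrite -subr_eq0 -sqrf_eq0 eq_le sqr_ge0 andbT.
have [r0|r0] := ltrP 0 (rinner x x); last first.
  have {r0} x0 : x = 0 by apply/rinner_eq0/le_anti; rewrite r0 rinner_ge0.
  have phi0 : phi 0 = 0 by have := phiD 0 0; rewrite addr0; lra.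
  by rewrite x0 phi0 rinner0l subr0 expr0n.
apply/ler_addgt0Pr => e e0; rewrite add0r.
have e'0 : 0 < e / (4 * rinner x x) by rewrite divr_gt0// mulr_gt0.
near \oo => n.
have h1 : rinner (z - u n) (z - u n) < e / (4 * rinner x x).
  by near: n; move/cvg_rinnerP : uz; apply.
have h2 : q (u n) - d < e / (4 * rinner x x) by near: n; exact: uN.
have h3 := near_stationary (u n) x.
have := psd_cauchy_schwarz x (z - u n) rinner_psd.
have -> : rinner x (z - u n) = rinner x z - rinner x (u n) by rewrite !rinnerE.
move: h1 h2; rewrite !ltr_pdivlMr ?mulr_gt0//; move: h3.
move: (rinner (z - u n) _) (rinner x x) (q _ - d) (phi x) (rinner x z) (rinner x (u n)).
move=> s r w p b a; have := sqr_ge0 (p - a + (b - a)); lra.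
Unshelve. all: by end_near. Qed.

End riesz.

(** Riesz for the real part of [inner (T x) y] gives a witness, so the default value in [adjoint] is
    not reached. *)
Lemma adjointP {R : realType} {H K : hilbertType R} (T : {linear H -> K}) :
  bounded_op T -> forall x y, inner (T x) y = inner x (adjoint T y).
Proof.
move=> /bounded_op_rinner[M M0 TM] x y.
have [||||z zP] := @riesz _ _ (fun x => rinner (T x) y) (M * rinner y y).
- by rewrite mulr_ge0 ?rinner_ge0 ?ltW.
- by move=> u v; rewrite linearD rinnerDl.
- by move=> t u; rewrite linearZ rinnerZl.
- move=> u; rewrite mulrAC (le_trans (psd_cauchy_schwarz _ _ rinner_psd))//.
  by rewrite ler_wpM2r// rinner_ge0.
suff : [set z | forall x, inner (T x) y = inner x z] (adjoint T y) by apply.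
apply: (@xgetPex _ 0); exists z => u; apply: inner_eqP => a.
by rewrite -linearZ -zP.
Qed.

(** * Unconditional sums *)

(* [totally_filter] is declared inside a section, so it is not exported. *)
#[local] Existing Instance totally_filter.

Section unconditional_sums.
Context {I : choiceType} {K : numFieldType} {V : normedModType K}.
Implicit Types x y : I -> V.

Lemma partial_sumD x y A :
  partial_sum (fun i => x i + y i) A = partial_sum x A + partial_sum y A.
Proof. exact: big_split. Qed.

Lemma partial_sumZ k x A :
  partial_sum (fun i => k *: x i) A = k *: partial_sum x A.
Proof. by rewrite /partial_sum scaler_sumr. Qed.

Lemma cvg_sumD x y : unconditional_cvg x -> unconditional_cvg y ->
  partial_sum (fun i => x i + y i) @ totally --> sum x + sum y.
Proof.
move=> xc yc; rewrite (_ : partial_sum _ = partial_sum x \+ partial_sum y).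
  exact: cvgD.
by apply/funext => A; exact: partial_sumD.
Qed.

Lemma cvg_sumZ k x : unconditional_cvg x ->
  partial_sum (fun i => k *: x i) @ totally --> k *: sum x.
Proof.
move=> xc; rewrite (_ : partial_sum _ = k \*: partial_sum x).
  exact: cvgZl_tmp.
by apply/funext => A; exact: partial_sumZ.
Qed.

Lemma unconditional_cvgD x y : unconditional_cvg x -> unconditional_cvg y ->
  unconditional_cvg (fun i => x i + y i).
Proof. by move=> xc yc; apply/cvg_ex; eexists; exact: cvg_sumD. Qed.

Lemma unconditional_cvgZ k x : unconditional_cvg x ->
  unconditional_cvg (fun i => k *: x i).
Proof. by move=> xc; apply/cvg_ex; eexists; exact: cvg_sumZ. Qed.

Lemma sumD x y : unconditional_cvg x -> unconditional_cvg y ->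
  sum (fun i => x i + y i) = sum x + sum y.
Proof. by move=> xc yc; apply/cvg_lim => //; exact: cvg_sumD. Qed.

Lemma sumZ k x : unconditional_cvg x -> sum (fun i => k *: x i) = k *: sum x.
Proof. by move=> xc; apply/cvg_lim => //; exact: cvg_sumZ. Qed.

End unconditional_sums.

(** * Complex-valued unconditional sums *)

Section complex_sums.
Context {R : realType}.

Lemma cvg_Re {T} {F : set_system T} {FF : Filter F} (u : T -> R[i]) (l : R[i]) :
  u @ F --> l -> (fun t => complex.Re (u t)) @ F --> complex.Re l.
Proof.
move=> /cvgrPdist_lt ul; apply/cvgrPdist_lt => e e0.
have : 0 < e%:C by rewrite ltcR.
move=> /ul; apply: filterS => t; rewrite -raddfB -ltcR.
exact: le_lt_trans (normc_ge_Re _).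
Qed.

Lemma cvg_conjc {T} {F : set_system T} {FF : Filter F} (u : T -> R[i]) (l : R[i]) :
  u @ F --> l -> (fun t => (u t)^*) @ F --> l^*.
Proof.
move=> /cvgrPdist_lt ul; apply/cvgrPdist_lt => e /ul; apply: filterS => t.
by rewrite -rmorphB normcJ.
Qed.

Context {I : choiceType}.
Implicit Types x : I -> R[i].

Lemma sum_conjc x : unconditional_cvg x -> sum (fun i => (x i)^*) = (sum x)^*.
Proof.
move=> /cvg_conjc xc; apply/cvg_lim => //.
rewrite (_ : partial_sum _ = fun A => (partial_sum x A)^*)//.
by apply/funext => A; rewrite /partial_sum rmorph_sum.
Qed.

Lemma le_partial_sum x (A B : {fset I}) : (A `<=` B)%fset -> (forall i, 0 <= x i) ->
  partial_sum x A <= partial_sum x B.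
Proof.
move=> AB x0; rewrite /partial_sum -!(big_seq_fsetE _ _ predT x).
rewrite (big_fsetID _ (mem A) B)/=.
have -> : [fset i in B | i \in A]%fset = A.
  by apply/fsetP => i; rewrite !inE/= andbC; case: (boolP (i \in A)) => // /(fsubsetP AB).
by rewrite ler_wpDr// sumr_ge0.
Qed.

(** Partial sums increase with the index set, and the sets containing [A] are eventual for
    [totally]. *)
Lemma Re_partial_sum_le x A : unconditional_cvg x -> (forall i, 0 <= x i) ->
  complex.Re (partial_sum x A) <= complex.Re (sum x).
Proof.
move=> xc x0.
have Rc : (fun B => complex.Re (partial_sum x B)) @ totally --> complex.Re (sum x).
  exact: cvg_Re.
rewrite -(cvg_lim _ Rc)//; apply: limr_ge; first by apply/cvg_ex; eexists; exact: Rc.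
exists A => // B /= AB.
by have := le_partial_sum AB x0; rewrite lecE => /andP[].
Qed.

End complex_sums.

(** * Polarization and convergence of mixed sums *)

Section polarization.
Context {R : realType} {H : hilbertType R}.

(** Bracketed as a sum of scaled diagonal terms, so that convergence of the diagonal sums carries
    over term by term. *)
Lemma polarization {G : hilbertType R} (T U : {linear H -> G}) (f g : H) :
  let s h := inner (T h) (U h) in
  inner (T f) (U g) = 4^-1 * s (f + g) + - 4^-1 * s (f - g) +
    (4^-1 * 'i%C * s (f + 'i%C *: g) + - (4^-1 * 'i%C) * s (f - 'i%C *: g)).
Proof.
move=> s; have sE (a b : R[i]) : a^* = b -> s (f + a *: g) =
    inner (T f) (U f) + a * inner (T g) (U f)
    + (b * inner (T f) (U g) + b * a * inner (T g) (U g)).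
  move=> <-.
  rewrite /s [T (_ + _)]linearD [U (_ + _)]linearD [T (_ *: _)]linearZ [U (_ *: _)]linearZ/=.
  rewrite innerC !innerDl !innerZl rmorphD rmorphM/= -!innerC !innerDl !innerZl.
  by ring.
have s1 := sE 1 1; have sN1 := sE (-1) (-1).
have si := sE 'i%C (- 'i%C); have sNi := sE (- 'i%C) 'i%C.
rewrite scale1r in s1; rewrite scaleN1r in sN1; rewrite scaleNr in sNi.
rewrite s1 ?sN1 ?si ?sNi;
  try by apply/eqP; rewrite eq_complex/= ?oppr0 ?opprK !eqxx.
have := sqr_i R; move: ('i%C) => j j2.
move: (inner (T f) (U f)) (inner (T f) (U g)) (inner (T g) (U f)) (inner (T g) (U g)).
move=> a b c d.
apply: (@mulfI _ 4); first by rewrite pnatr_eq0.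
rewrite (_ : 4 * (_ + _) = 2 * (b + c) - 2 * j ^+ 2 * (b - c)); last by field.
by rewrite j2; ring.
Qed.

Lemma unconditional_cvg_polarization {I : choiceType} {H_ : I -> hilbertType R}
    (T U : forall i, {linear H -> H_ i}) :
  (forall f, unconditional_cvg (fun i => inner (T i f) (U i f))) ->
  forall f g, unconditional_cvg (fun i => inner (T i f) (U i g)).
Proof.
move=> TU f g.
have Z (k : R[i]) h : unconditional_cvg (fun i => k * inner (T i h) (U i h)).
  exact: (unconditional_cvgZ (TU h)).
rewrite (_ : (fun i => _) = fun i => 4^-1 * inner (T i (f + g)) (U i (f + g))
    + - 4^-1 * inner (T i (f - g)) (U i (f - g)) +
    (4^-1 * 'i%C * inner (T i (f + 'i%C *: g)) (U i (f + 'i%C *: g)) +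
    - (4^-1 * 'i%C) * inner (T i (f - 'i%C *: g)) (U i (f - 'i%C *: g)))).
  by apply: unconditional_cvgD; apply: unconditional_cvgD; exact: Z.
by apply/funext => i; exact: polarization.
Qed.

End polarization.

(** * Frame forms and frame operators *)

Section frame_form.
Context {R : realType} {H : hilbertType R} {I : choiceType} {H_ : I -> hilbertType R}.
Variable L : forall i, {linear H -> H_ i}.
Hypothesis L_cvg : forall f, unconditional_cvg (fun i => inner (L i f) (L i f)).

(** The form [<f, g>_S], given by a scalar series so that it is available before [gframe_op] is
    known to converge. *)
Definition frame_form f g : R[i] := sum (fun i => inner (L i f) (L i g)).

Let frame_cvg f g : unconditional_cvg (fun i => inner (L i f) (L i g)).
Proof. exact: unconditional_cvg_polarization. Qed.

Lemma frame_formDl f g h : frame_form (f + g) h = frame_form f h + frame_form g h.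
Proof.
rewrite /frame_form -(sumD (@frame_cvg f h) (@frame_cvg g h)); congr sum; apply/funext => i.
by rewrite linearD innerDl.
Qed.

Lemma frame_formZl a f g : frame_form (a *: f) g = a * frame_form f g.
Proof.
rewrite /frame_form -[RHS](sumZ _ (@frame_cvg f g)); congr sum; apply/funext => i.
by rewrite linearZ innerZl.
Qed.

Lemma frame_formC f g : frame_form g f = (frame_form f g)^*.
Proof.
by rewrite /frame_form -(sum_conjc (@frame_cvg f g)); congr sum; apply/funext => i; rewrite innerC.
Qed.

Lemma frame_form_psd : psd_form (fun f g => complex.Re (frame_form f g)).
Proof.
split=> [f g|f g h|t f g|f].
- by rewrite frame_formC; case: (frame_form g f).
- by rewrite frame_formDl raddfD.
- by rewrite frame_formZl Re_mul_real.
- have := @Re_partial_sum_le _ _ _ fset0 (@L_cvg f).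
  rewrite /partial_sum big_fset0; apply => i.
  by rewrite innerxx ler0c rinner_ge0.
Qed.

Lemma frame_formxx f : frame_form f f = (complex.Re (frame_form f f))%:C.
Proof.
have := frame_formC f f; case: (frame_form f f) => u v /= [] v0.
by congr Complex; lra.
Qed.

Lemma frame_formDr f g h : frame_form f (g + h) = frame_form f g + frame_form f h.
Proof. by rewrite frame_formC frame_formDl rmorphD/= -!frame_formC. Qed.

Lemma frame_formZir f g : frame_form f ('i%C *: g) = - ('i%C * frame_form f g).
Proof.
rewrite frame_formC frame_formZl [frame_form g f]frame_formC.
case: (frame_form f g) => u v; apply/eqP; rewrite eq_complex/=.
by apply/andP; split; apply/eqP; ring.
Qed.

(** Forwards, the imaginary part at [f + 'i g] is the difference of the two mixed real parts;
    backwards, take [g = 'i f]. *)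
Lemma frame_form_real_sym (C : {linear H -> H}) :
  (forall f, complex.Im (frame_form (C f) f) = 0) <->
  (forall f g, complex.Re (frame_form (C f) g) = complex.Re (frame_form f (C g))).
Proof.
split=> [Cr f g|Cs f].
  have := Cr (f + 'i%C *: g); have := Cr f; have := Cr g.
  rewrite linearD linearZ/= !frame_formDl !frame_formZl !frame_formDr !frame_formZir.
  rewrite [frame_form f (C g)]frame_formC.
  case: (frame_form (C f) f) (frame_form (C g) g) => [a b] [c d].
  by case: (frame_form (C f) g) (frame_form (C g) f) => [a' b'] [c' d'] /=; lra.
have := Cs f ('i%C *: f).
rewrite linearZ/= !frame_formZir [frame_form f (C f)]frame_formC.
by case: (frame_form (C f) f) => [a b] /=; lra.
Qed.

End frame_form.

Section frame_operator.
Context {R : realType} {H : hilbertType R} {J : set int} {H_ : J -> hilbertType R}.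
Variable L : forall i : J, {linear H -> H_ i}.
Hypothesis L_bd : forall i, bounded_op (L i).
Hypothesis L_cvg : forall f, unconditional_cvg (fun i => inner (L i f) (L i f)).
Variable B : R.
Hypothesis B0 : 0 < B.
Hypothesis bessel : forall f, complex.Re (frame_form L f f) <= B * rinner f f.

(** Riesz represents the frame form at [f] by a vector [z]; the work is to show that the series of
    [gframe_op] converges to [z] in norm. *)
Lemma gframe_opE f x : rinner (gframe_op L f) x = complex.Re (frame_form L f x).
Proof.
have FP := frame_form_psd L_cvg.
have [|||y|z zP] := @riesz _ _ (fun x => complex.Re (frame_form L x f))
    (B * complex.Re (frame_form L f f)).
- by rewrite mulr_ge0 ?(psd_ge0 FP)// ltW.
- by move=> u v; rewrite (psdD FP).
- by move=> t u; rewrite (psdZ FP).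
- apply: (le_trans (psd_cauchy_schwarz y f FP)).
  by rewrite mulrAC ler_wpM2r// (psd_ge0 FP).
suff -> : gframe_op L f = z by rewrite rinnerC -zP (psdC FP).
apply/cvg_lim => //; apply/cvg_rinnerP => e e0.
pose s A g h : R := complex.Re (partial_sum (fun i => inner (L i g) (L i h)) A).
have sE A g h : s A g h = \sum_(i : A) rinner (L (val i) g) (L (val i) h).
  by rewrite /s /partial_sum raddf_sum.
have rinner_partial A g : rinner (partial_sum (fun i => adjoint (L i) (L i f)) A) g = s A f g.
  rewrite sE /partial_sum.
  elim/big_rec2 : _ => [|i y1 y2 _ <-]; first exact: rinner0l.
  by rewrite rinnerDl; congr (_ + _); rewrite rinnerC /rinner -adjointP// -/(rinner _ _) rinnerC.
(* [D A] is the form of [S - S_A], for the partial sum [S_A] of [S]; since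
   [0 <= S - S_A <= B], [|(S - S_A) f|^2 <= B <(S - S_A) f, f>], so that weak
   convergence implies strong convergence. *)
pose D A g h := complex.Re (frame_form L g h) - s A g h.
have DP A : psd_form (D A).
  split=> [g h|g h k|t g h|g]; rewrite /D.
  - rewrite (psdC FP) !sE; congr (_ - _).
    by apply: eq_bigr => i _; rewrite rinnerC.
  - rewrite (psdD FP) !sE [RHS]addrACA -opprD -big_split/=; congr (_ - _).
    by apply: eq_bigr => i _; rewrite linearD rinnerDl.
  - rewrite (psdZ FP) !sE mulrBr mulr_sumr; congr (_ - _).
    by apply: eq_bigr => i _; rewrite linearZ/= rinnerZl.
  - rewrite subr_ge0; apply: Re_partial_sum_le; first exact: L_cvg.
    by move=> i; rewrite innerxx ler0c rinner_ge0.
have D_le A g : D A g g <= B * rinner g g.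
  apply: le_trans (bessel g); rewrite lerBlDr lerDl sE.
  by apply: sumr_ge0 => i _; exact: rinner_ge0.
have : (fun A => s A f f) @ totally --> complex.Re (frame_form L f f).
  by apply: cvg_Re; exact: L_cvg.
move=> /cvgrPdist_lt/(_ (e / B)); rewrite divr_gt0// => /(_ isT).
apply: filterS => A; rewrite -/(D A f f) ger0_norm ?(psd_ge0 (DP A))//.
rewrite ltr_pdivlMr// => De.
set w := z - _.
have wE g : rinner w g = D A f g.
  by rewrite /w rinnerDl rinnerNl rinner_partial rinnerC -zP (psdC FP).
have [w0|w0] := lerP (rinner w w) 0; first exact: le_lt_trans e0.
(* Cauchy-Schwarz for [D A] at [f] and [w], then division by [rinner w w]. *)
apply: le_lt_trans De; rewrite -(ler_pM2r w0) -expr2 wE.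
apply: (le_trans (psd_cauchy_schwarz f w (DP A))); rewrite -mulrA -(wE w).
by rewrite ler_wpM2l// (psd_ge0 (DP A)).
Qed.

End frame_operator.

(** * Controlled g-frames and commuting positive controls *)

Theorem proposition4p4 (R : realType) (H : hilbertType R) (J : set int)
    (H_ : J -> hilbertType R)
    (sepH : separable H) (sepH_ : forall i : J, separable (H_ i))
    (C : {linear H -> H}) (C_GL : inGL C) (C_sa : self_adjoint C)
    (L : forall i : J, {linear H -> H_ i}) (L_bd : forall i : J, bounded_op (L i)) :
  controlled_gframe C L <->
  [/\ gframe L, positive_op C & forall f : H, C (gframe_op L f) = gframe_op L (C f)].
Proof.
have [C_bd [U [U_bd CK UK]]] := C_GL.
have [Kc Kc0 Cle] := bounded_op_rinner C_bd.
have [Ku Ku0 Ule] := bounded_op_rinner U_bd.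
have Cadj x y : inner (C x) y = inner x (C y) by rewrite adjointP// C_sa.
have rC x y : rinner (C x) y = rinner x (C y) by rewrite /rinner Cadj.
have rP := @rinner_psd R H.
have Ule' x : rinner x x <= Ku * rinner (C x) (C x) by rewrite -{1 2}[x]CK.
have CD x y : C (x + y) = C x + C y by rewrite linearD.
have CZ t x : C (t *: x) = t *: C x by rewrite linearZ.
pose F := frame_form L.
pose FF f g := complex.Re (F f g).
pose Lcvg := forall f, unconditional_cvg (fun i => inner (L i f) (L i f)).
have CformP (lc : Lcvg) :
    (forall f g, complex.Re (F (C f) g) = complex.Re (F f (C g))) ->
    (forall f, 0 <= complex.Re (F (C f) f)) ->
  psd_form (fun f g => complex.Re (F (C f) g)).
  move=> Fs F0; have FP := frame_form_psd lc; split=> [f g|f g h|t f g|//].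
  - by rewrite (psdC FP (C f) g) Fs.
  - by rewrite linearD (psdD FP).
  - by rewrite linearZ (psdZ FP).
have normE f : (fun i : J => `|L i f| ^+ 2) = (fun i => inner (L i f) (L i f)).
  by apply/funext => i; rewrite normr_inner.
have sumE (lc : Lcvg) f : sum (fun i : J => `|L i f| ^+ 2) = (FF f f)%:C.
  by rewrite normE; exact: frame_formxx lc f.
have sumCE f : sum (fun i : J => inner (L i (adjoint C f)) (L i f)) = F (C f) f.
  by rewrite C_sa.
split.
- move=> [m [M [m0 ctl]]].
  have ccvg f : unconditional_cvg (fun i : J => inner (L i (C f)) (L i f)).
    by have [+ _ _ _] := ctl f; rewrite C_sa.
  have lc : Lcvg.
    (* The mixed sums of [L (C g)] against [L f] converge; take [g = U f]. *)
    move=> f; have := @unconditional_cvg_polarization _ _ _ _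
      (fun i => (L i \o C : {linear H -> H_ i})) L ccvg (U f) f.
    by rewrite /= UK.
  have FP := frame_form_psd lc.
  have Freal f : complex.Im (F (C f) f) = 0.
    have [_ + _ _] := ctl f; rewrite sumCE.
    by case: (F (C f) f) => u v; rewrite complex_real => /eqP.
  have Flow f : m * rinner f f <= complex.Re (F (C f) f).
    have [_ _ + _] := ctl f; rewrite sumCE sqr_norm -rmorphM/= lecE.
    by move=> /andP[].
  (* The given [M] carries no sign; the maximum makes the constant positive. *)
  pose M' := Num.max M 1.
  have M'0 : 0 < M' by rewrite lt_max ltr01 orbT.
  have Fup f : complex.Re (F (C f) f) <= M' * rinner f f.
    have [_ _ _] := ctl f; rewrite sumCE sqr_norm -rmorphM/= lecE.
    move=> /andP[_ /=] /le_trans; apply.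
    by rewrite ler_wpM2r ?rinner_ge0// le_max lexx.
  have Fsym := (frame_form_real_sym lc C).1 Freal.
  have FC0 f : 0 <= complex.Re (F (C f) f).
    by apply: le_trans (Flow f); rewrite mulr_ge0 ?rinner_ge0// ltW.
  pose B := M' * (Ku + 1).
  have B0 : 0 < B by rewrite mulr_gt0// addr_gt0.
  have FB f : complex.Re (F f f) <= B * rinner f f.
    exact: (psd_upper (a := FF) M'0 Ku0 rP (CformP lc Fsym FC0) UK Fup Ule).
  pose A := m ^+ 2 / (B * Kc).
  have A0 : 0 < A by rewrite divr_gt0 ?exprn_gt0// mulr_gt0.
  have FA f : A * rinner f f <= complex.Re (F f f).
    exact: (psd_lower (a := FF) m0 B0 Kc0 FP rP Flow FB Cle).
  split.
  + exists A, B; split=> // f; rewrite /= sumE// sqr_norm -!rmorphM/= !lecR normE.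
    by split; [exact: lc|exact: FA|exact: FB].
  + have rF f : rinner f f <= A^-1 * FF f f by rewrite mulrC ler_pdivlMr// mulrC; exact: FA.
    have rCle f : `|rinner (C f) f| <= (Kc + 1) * rinner f f.
      exact: psd_normr_le (ltW Kc0) rP Cle f.
    (* The lower bound [m] relative to the norm becomes [m / B] relative to the frame form, as
       [psd_transfer] requires. *)
    have FClow f : m / B * FF f f <= FF (C f) f.
      apply: le_trans (Flow f).
      rewrite mulrAC ler_pdivrMr// -mulrA ler_pM2l// mulrC; exact: FB.
    have mB0 : 0 < m / B by rewrite divr_gt0.
    have Ai0 : 0 < A^-1 by rewrite invr_gt0.
    have Kc1 : 0 < Kc + 1 by rewrite addr_gt0.
    have [m' m'0 Cm] := psd_transfer (a := FF) FP rP mB0 B0 Ai0 Kc1 FB rF CD CZ rC rCle FClow.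
    move=> f; have -> : inner (C f) f = (rinner (C f) f)%:C.
      have := innerC (C f) f; rewrite -Cadj /rinner.
      by case: (inner (C f) f) => u v [] h; congr Complex; lra.
    by rewrite ler0c (le_trans _ (Cm f))// mulr_ge0 ?rinner_ge0// ltW.
  (* [<C S f, g> = <S f, C g> = <f, C g>_S = <C f, g>_S = <S C f, g>] in real parts. *)
  + move=> f; apply: rinner_inj => g.
    by rewrite rC !(gframe_opE L_bd lc B0 FB) Fsym.
- move=> [[A [B [A0 B0 gf]]] Cpos Ccomm].
  have lc : Lcvg by move=> f; have [+ _ _] := gf f; rewrite normE.
  have FP := frame_form_psd lc.
  have FB f : complex.Re (F f f) <= B * rinner f f.
    by have [_ _] := gf f; rewrite sumE// sqr_norm -rmorphM/= lecR.
  have FA f : A * rinner f f <= complex.Re (F f f).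
    by have [_ + _] := gf f; rewrite sumE// sqr_norm -rmorphM/= lecR.
  (* The same chain backwards: commutation with [S] makes [C] symmetric for the frame form. *)
  have Fsym f g : complex.Re (F (C f) g) = complex.Re (F f (C g)).
    by rewrite -!(gframe_opE L_bd lc B0 FB) -Ccomm rC.
  have Freal := (frame_form_real_sym lc C).2 Fsym.
  have Kc1 : 0 < Kc + 1 by rewrite addr_gt0.
  have rCP : psd_form (fun f g => rinner (C f) g).
    split=> [f g|f g h|t f g|f].
    * by rewrite rC rinnerC.
    * by rewrite linearD rinnerDl.
    * by rewrite linearZ rinnerZl.
    * by have := Cpos f; rewrite lecE => /andP[].
  have rCle f : `|rinner (C f) f| <= (Kc + 1) * rinner f f.
    exact: psd_normr_le (ltW Kc0) rP Cle f.
  (* A positive invertible operator is bounded below: [rinner f f] is at most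
     [Ku * rinner (C f) (C f)], and [psd_sqr_le] bounds this by [Ku * (Kc + 1) * rinner (C f) f]. *)
  have Clow f : (Ku * (Kc + 1))^-1 * rinner f f <= rinner (C f) f.
    rewrite mulrC ler_pdivrMr ?mulr_gt0// (le_trans (Ule' f))// [leRHS]mulrC -mulrA ler_pM2l//.
    apply: psd_sqr_le (ltW Kc1) rP rCP _ f => g.
    exact: le_trans (ler_norm _) (rCle g).
  have rF f : rinner f f <= A^-1 * FF f f by rewrite mulrC ler_pdivlMr// mulrC; exact: FA.
  (* Equivalence of the two forms makes [C] bounded for the frame form as well. *)
  have FCle f : complex.Re (F (C f) (C f)) <= (B * Kc / A) * complex.Re (F f f).
    apply: (le_trans (FB _)); rewrite -!mulrA ler_pM2l// (le_trans (Cle _))//.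
    by rewrite ler_pM2l//; exact: rF.
  pose K := B * Kc / A.
  have K0 : 0 < K by rewrite divr_gt0// mulr_gt0.
  have FCn f : `|complex.Re (F (C f) f)| <= (K + 1) * complex.Re (F f f).
    exact: (psd_normr_le (b := FF) (ltW K0) FP FCle).
  have Ku0' : 0 < (Ku * (Kc + 1))^-1 by rewrite invr_gt0 mulr_gt0.
  have Ai0 : 0 < A^-1 by rewrite invr_gt0.
  have K10 : 0 < K + 1 by rewrite addr_gt0.
  (* The roles are exchanged: the bound below for the inner product passes to the frame form, and
     [A] and [B] convert the result back to the norm. *)
  have [m' m'0 Cm] := psd_transfer (b := FF) rP FP Ku0' Ai0 B0 K10 rF FB CD CZ Fsym FCn Clow.
  exists (m' * A), ((K + 1) * B); split=> [|f]; first exact: mulr_gt0.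
  rewrite /= sumCE.
  have FE : F (C f) f = (complex.Re (F (C f) f))%:C.
    by have := Freal f; rewrite -/(F (C f) f); case: (F (C f) f) => u v /= ->.
  split.
  + rewrite C_sa; exact: (unconditional_cvg_polarization lc).
  + by rewrite FE complex_real.
  + rewrite FE sqr_norm -rmorphM/= lecR (le_trans _ (Cm f))//.
    by rewrite -mulrA ler_pM2l.
  + rewrite FE sqr_norm -rmorphM/= lecR (le_trans (ler_norm _))// (le_trans (FCn f))//.
    by rewrite -mulrA ler_pM2l// addr_gt0.
Qed.
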